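(* Assume $q$ is not a root of unity. For every $d\in\mathbb N$ there exists an $\mathcal A$-module isomorphism $L(d,1)\to L(d,-1)$ that sends $u_i\mapsto u_i$ for $0\le i\le d$ (i.e. sends the $i$-th vector of the basis $\{u_i\}_{i=0}^d$ of $L(d,1)$ to the $i$-th vector of the corresponding basis of $L(d,-1)$).
   Context: $\mathbb K$ is a field and $q$ is a nonzero scalar in $\mathbb K$ that is not a root of unity (in particular $q^2\ne1$). $\mathbb N=\{0,1,2,\ldots\}$. $U_q(\mathfrak{sl}_2)$ is the unital associative $\mathbb K$-algebra with generators $x,y,y^{-1},z$ and relations $yy^{-1}=y^{-1}y=1$, $\frac{qxy-q^{-1}yx}{q-q^{-1}}=1$, $\frac{qyz-q^{-1}zy}{q-q^{-1}}=1$, $\frac{qzx-q^{-1}xz}{q-q^{-1}}=1$. $\mathcal A$ is the $\mathbb K$-subalgebra of $U_q(\mathfrak{sl}_2)$ spanned by $x^ry^sz^t$ with $r,s,t\in\mathbb N$ and $r+s+t$ even. For $d\in\mathbb N$ and $\epsilon\in\{1,-1\}$, $L(d,\epsilon)$ is the (known, irreducible) $U_q(\mathfrak{sl}_2)$-module with basis $\{u_i\}_{i=0}^d$ such that for $0\le i\le d$: $(\epsilon x-q^{d-2i})u_i=(q^{-d}-q^{d-2i+2})u_{i-1}$, $(\epsilon y-q^{d-2i})u_i=(q^d-q^{d-2i-2})u_{i+1}$, $\epsilon z u_i=q^{2i-d}u_i$, where $u_{-1}=u_{d+1}=0$. Each $L(d,\epsilon)$ is regarded as an $\mathcal A$-module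 by restriction. *)

(* Defs.v *)
From HB Require Import structures.
From mathcomp Require Import all_boot all_order all_algebra.
From mathcomp Require Import generic_quotient boolp.
From mathcomp Require Import zify ring.

Set Implicit Arguments.
Unset Strict Implicit.
Unset Printing Implicit Defensive.

Import Order.TTheory GRing.Theory Num.Theory.
Local Open Scope quotient_scope.
Local Open Scope ring_scope.

Definition not_root_of_unity (K : fieldType) (q : K) : Prop :=
  forall n : nat, (0 < n)%N -> q ^+ n != 1.

Inductive uq_term (K : Type) : Type :=
| TX | TY | TYi | TZ | T0 | T1
| TOpp of uq_term K
| TAdd of uq_term K & uq_term K
| TMul of uq_term K & uq_term K
| TScale of K & uq_term K.

Arguments TX {K}.
Arguments TY {K}.
Arguments TYi {K}.
Arguments TZ {K}.
Arguments T0 {K}.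
Arguments T1 {K}.

HB.instance Definition _ (K : Type) := gen_eqMixin (uq_term K).
HB.instance Definition _ (K : Type) := gen_choiceMixin (uq_term K).

(* q-commutator-type relator (q a b - q^-1 b a) / (q - q^-1) *)
Definition qrel_term (K : fieldType) (q : K) (a b : uq_term K) : uq_term K :=
  TScale (q - q^-1)^-1
    (TAdd (TScale q (TMul a b)) (TOpp (TScale q^-1 (TMul b a)))).

(* The least congruence making terms a unital associative K-algebra in which
   the defining relations hold. *)
Inductive uq_cong (K : fieldType) (q : K) : uq_term K -> uq_term K -> Prop :=
| cg_refl a : uq_cong q a a
| cg_sym a b : uq_cong q a b -> uq_cong q b a
| cg_trans a b c : uq_cong q a b -> uq_cong q b c -> uq_cong q a c
| cg_opp a b : uq_cong q a b -> uq_cong q (TOpp a) (TOpp b)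
| cg_add a b a' b' : uq_cong q a a' -> uq_cong q b b' ->
    uq_cong q (TAdd a b) (TAdd a' b')
| cg_mul a b a' b' : uq_cong q a a' -> uq_cong q b b' ->
    uq_cong q (TMul a b) (TMul a' b')
| cg_scale k a b : uq_cong q a b -> uq_cong q (TScale k a) (TScale k b)
| cg_addA a b c : uq_cong q (TAdd a (TAdd b c)) (TAdd (TAdd a b) c)
| cg_addC a b : uq_cong q (TAdd a b) (TAdd b a)
| cg_add0 a : uq_cong q (TAdd T0 a) a
| cg_addN a : uq_cong q (TAdd (TOpp a) a) T0
| cg_mulA a b c : uq_cong q (TMul a (TMul b c)) (TMul (TMul a b) c)
| cg_mul1l a : uq_cong q (TMul T1 a) a
| cg_mul1r a : uq_cong q (TMul a T1) a
| cg_mulDl a b c : uq_cong q (TMul (TAdd a b) c) (TAdd (TMul a c) (TMul b c))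
| cg_mulDr a b c : uq_cong q (TMul a (TAdd b c)) (TAdd (TMul a b) (TMul a c))
| cg_scaleA k l a : uq_cong q (TScale k (TScale l a)) (TScale (k * l) a)
| cg_scale1 a : uq_cong q (TScale 1 a) a
| cg_scaleDr k a b :
    uq_cong q (TScale k (TAdd a b)) (TAdd (TScale k a) (TScale k b))
| cg_scaleDl k l a :
    uq_cong q (TScale (k + l) a) (TAdd (TScale k a) (TScale l a))
| cg_scaleAl k a b : uq_cong q (TScale k (TMul a b)) (TMul (TScale k a) b)
| cg_scaleAr k a b : uq_cong q (TScale k (TMul a b)) (TMul a (TScale k b))
| cg_yyi : uq_cong q (TMul TY TYi) T1
| cg_yiy : uq_cong q (TMul TYi TY) T1
| cg_xy : uq_cong q (qrel_term q TX TY) T1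
| cg_yz : uq_cong q (qrel_term q TY TZ) T1
| cg_zx : uq_cong q (qrel_term q TZ TX) T1.

Definition uq_relations (K : fieldType) (q : K) (B : algType K)
    (x y yi z : B) : Prop :=
  [/\ y * yi = 1, yi * y = 1,
      (q - q^-1)^-1 *: (q *: (x * y) - q^-1 *: (y * x)) = 1,
      (q - q^-1)^-1 *: (q *: (y * z) - q^-1 *: (z * y)) = 1
    & (q - q^-1)^-1 *: (q *: (z * x) - q^-1 *: (x * z)) = 1].

Fixpoint uq_eval (K : fieldType) (B : algType K) (x y yi z : B)
    (t : uq_term K) : B :=
  match t with
  | TX => x | TY => y | TYi => yi | TZ => z | T0 => 0 | T1 => 1
  | TOpp a => - uq_eval x y yi z a
  | TAdd a b => uq_eval x y yi z a + uq_eval x y yi z b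
  | TMul a b => uq_eval x y yi z a * uq_eval x y yi z b
  | TScale k a => k *: uq_eval x y yi z a
  end.

Lemma uq_eval_cong (K : fieldType) (q : K) (B : algType K) (x y yi z : B) :
  uq_relations q x y yi z ->
  forall a b, uq_cong q a b -> uq_eval x y yi z a = uq_eval x y yi z b.
Proof.
move=> [r1 r2 r3 r4 r5] a b; elim=> //=.
- by move=> {}a {}b c _ -> _ ->.
- by move=> {}a {}b _ ->.
- by move=> {}a {}b a' b' _ -> _ ->.
- by move=> {}a {}b a' b' _ -> _ ->.
- by move=> k {}a {}b _ ->.
- by move=> *; rewrite addrA.
- by move=> *; rewrite addrC.
- by move=> *; rewrite add0r.
- by move=> *; rewrite addNr.
- by move=> *; rewrite mulrA.
- by move=> *; rewrite mul1r.
- by move=> *; rewrite mulr1.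
- by move=> *; rewrite mulrDl.
- by move=> *; rewrite mulrDr.
- by move=> *; rewrite scalerA.
- by move=> *; rewrite scale1r.
- by move=> *; rewrite scalerDr.
- by move=> *; rewrite scalerDl.
- by move=> *; rewrite scalerAl.
- by move=> *; rewrite scalerAr.
Qed.

Definition uq_congb (K : fieldType) (q : K) : rel (uq_term K) :=
  fun a b => `[< uq_cong q a b >].

Lemma uq_congb_refl (K : fieldType) (q : K) : reflexive (uq_congb q).
Proof. by move=> a; apply/asboolP; apply: cg_refl. Qed.

Lemma uq_congb_sym (K : fieldType) (q : K) : symmetric (uq_congb q).
Proof. by move=> a b; apply/asboolP/asboolP; apply: cg_sym. Qed.

Lemma uq_congb_trans (K : fieldType) (q : K) : transitive (uq_congb q).
Proof.
by move=> b a c /asboolP ab /asboolP bc; apply/asboolP; apply: cg_trans bc.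
Qed.

Canonical uq_equiv (K : fieldType) (q : K) : equiv_rel (uq_term K) :=
  EquivRel (uq_congb q) (uq_congb_refl q) (uq_congb_sym q)
    (@uq_congb_trans K q).

(* Both hypotheses on q are type parameters: without q ^+ 2 != 1 the
   presented algebra need not be nontrivial, as algType demands. *)
Definition Uq (K : fieldType) (q : K) (q0 : q != 0)
  (qn : not_root_of_unity q) : Type := {eq_quot (uq_equiv q)}.

Section UqAlgebra.
Variables (K : fieldType) (q : K) (q0 : q != 0) (qn : not_root_of_unity q).
Local Notation U := (Uq q0 qn).
Local Notation Q := {eq_quot (uq_equiv q)}.

HB.instance Definition _ := Choice.on U.

Definition uq_class (t : uq_term K) : U := \pi_Q t.

Lemma uq_classP a b : (uq_class a = uq_class b) <-> uq_cong q a b.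
Proof.
split; first by move/eqmodP/asboolP.
by move=> ab; apply/eqmodP/asboolP.
Qed.

Lemma uq_class_surj (u : U) : exists a, u = uq_class a.
Proof. by exists (repr (u : Q)); rewrite /uq_class reprK. Qed.

Let rp (u : U) : uq_term K := repr (u : Q).

Lemma uq_class_repr (u : U) : uq_class (rp u) = u.
Proof. by rewrite /uq_class reprK. Qed.

Lemma uq_repr_class a : uq_cong q (rp (uq_class a)) a.
Proof. by apply/uq_classP; rewrite uq_class_repr. Qed.

Definition uq_opp (u : U) : U := uq_class (TOpp (rp u)).
Definition uq_add (u v : U) : U := uq_class (TAdd (rp u) (rp v)).
Definition uq_mul (u v : U) : U := uq_class (TMul (rp u) (rp v)).
Definition uq_scale (k : K) (u : U) : U := uq_class (TScale k (rp u)).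

Lemma uq_oppE a : uq_opp (uq_class a) = uq_class (TOpp a).
Proof. by apply/uq_classP; apply: cg_opp; apply: uq_repr_class. Qed.
Lemma uq_addE a b : uq_add (uq_class a) (uq_class b) = uq_class (TAdd a b).
Proof. by apply/uq_classP; apply: cg_add; apply: uq_repr_class. Qed.
Lemma uq_mulE a b : uq_mul (uq_class a) (uq_class b) = uq_class (TMul a b).
Proof. by apply/uq_classP; apply: cg_mul; apply: uq_repr_class. Qed.
Lemma uq_scaleE k a : uq_scale k (uq_class a) = uq_class (TScale k a).
Proof. by apply/uq_classP; apply: cg_scale; apply: uq_repr_class. Qed.

Let E := (uq_oppE, uq_addE, uq_mulE, uq_scaleE).

Let addA : associative uq_add.
Proof.
move=> u v w; have [a ->] := uq_class_surj u; have [b ->] := uq_class_surj v.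
by have [c ->] := uq_class_surj w; rewrite !E; apply/uq_classP; constructor.
Qed.
Let addC : commutative uq_add.
Proof.
move=> u v; have [a ->] := uq_class_surj u; have [b ->] := uq_class_surj v.
by rewrite !E; apply/uq_classP; exact: cg_addC.
Qed.
Let add0 : left_id (uq_class T0) uq_add.
Proof.
by move=> u; have [a ->] := uq_class_surj u; rewrite !E; apply/uq_classP;
  exact: cg_add0.
Qed.
Let addN : left_inverse (uq_class T0) uq_opp uq_add.
Proof.
by move=> u; have [a ->] := uq_class_surj u; rewrite !E; apply/uq_classP;
  exact: cg_addN.
Qed.

HB.instance Definition _ := GRing.isZmodule.Build U addA addC add0 addN.

Let mulA : associative uq_mul.
Proof.
move=> u v w; have [a ->] := uq_class_surj u; have [b ->] := uq_class_surj v.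
by have [c ->] := uq_class_surj w; rewrite !E; apply/uq_classP;
  exact: cg_mulA.
Qed.
Let mul1l : left_id (uq_class T1) uq_mul.
Proof.
by move=> u; have [a ->] := uq_class_surj u; rewrite !E; apply/uq_classP;
  exact: cg_mul1l.
Qed.
Let mul1r' : right_id (uq_class T1) uq_mul.
Proof.
by move=> u; have [a ->] := uq_class_surj u; rewrite !E; apply/uq_classP;
  exact: cg_mul1r.
Qed.
Let mulDl : left_distributive uq_mul +%R.
Proof.
move=> u v w; have [a ->] := uq_class_surj u; have [b ->] := uq_class_surj v.
have [c ->] := uq_class_surj w.
by rewrite /GRing.add /= !E; apply/uq_classP; exact: cg_mulDl.
Qed.
Let mulDr : right_distributive uq_mul +%R.
Proof.
move=> u v w; have [a ->] := uq_class_surj u; have [b ->] := uq_class_surj v.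
have [c ->] := uq_class_surj w.
by rewrite /GRing.add /= !E; apply/uq_classP; exact: cg_mulDr.
Qed.

Lemma q_sub_qV_neq0 : q - q^-1 != 0.
Proof.
rewrite subr_eq0; apply/eqP => e; have /negP := qn (isT : (0 < 2)%N).
by apply; rewrite expr2 {2}e mulfV.
Qed.

Let one_neq0 : uq_class T1 != (0 : U).
Proof.
apply/eqP => /uq_classP c01.
have H : @uq_relations K q K^o 1 1 1 1.
  have h : (q - q^-1)^-1 *: (q *: (1 * 1 : K^o) - q^-1 *: (1 * 1 : K^o)) = 1.
    by rewrite mulr1 -scalerBl scalerA mulVf ?q_sub_qV_neq0 // scale1r.
  by split => //; exact: mulr1.
have /= /eqP := uq_eval_cong H c01.
by rewrite oner_eq0.
Qed.

HB.instance Definition _ :=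
  GRing.Zmodule_isNzRing.Build U mulA mul1l mul1r' mulDl mulDr one_neq0.

Let scaleA k l u : uq_scale k (uq_scale l u) = uq_scale (k * l) u.
Proof.
by have [a ->] := uq_class_surj u; rewrite !E; apply/uq_classP;
  exact: cg_scaleA.
Qed.
Let scale1 : left_id 1 uq_scale.
Proof.
by move=> u; have [a ->] := uq_class_surj u; rewrite !E; apply/uq_classP;
  exact: cg_scale1.
Qed.
Let scaleDr : right_distributive uq_scale +%R.
Proof.
move=> k u v; have [a ->] := uq_class_surj u; have [b ->] := uq_class_surj v.
by rewrite /GRing.add /= !E; apply/uq_classP; exact: cg_scaleDr.
Qed.
Let scaleDl u : {morph uq_scale^~ u : k l / k + l}.
Proof.
move=> k l; have [a ->] := uq_class_surj u.
by rewrite [RHS]/GRing.add /= !E; apply/uq_classP; exact: cg_scaleDl.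
Qed.

HB.instance Definition _ :=
  GRing.Zmodule_isLmodule.Build K U scaleA scale1 scaleDr scaleDl.

Let scaleAl (k : K) (u v : U) : k *: (u * v) = (k *: u) * v.
Proof.
have [a ->] := uq_class_surj u; have [b ->] := uq_class_surj v.
rewrite /GRing.scale /GRing.mul /= !E; apply/uq_classP; exact: cg_scaleAl.
Qed.

HB.instance Definition _ := GRing.Lmodule_isLalgebra.Build K U scaleAl.

Let scaleAr (k : K) (u v : U) : k *: (u * v) = u * (k *: v).
Proof.
have [a ->] := uq_class_surj u; have [b ->] := uq_class_surj v.
rewrite /GRing.scale /GRing.mul /= !E; apply/uq_classP; exact: cg_scaleAr.
Qed.

HB.instance Definition _ := GRing.Lalgebra_isAlgebra.Build K U scaleAr.

Definition uq_x : U := uq_class TX.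
Definition uq_y : U := uq_class TY.
Definition uq_yi : U := uq_class TYi.
Definition uq_z : U := uq_class TZ.

Lemma uq_class0 : uq_class T0 = 0. Proof. by []. Qed.
Lemma uq_class1 : uq_class T1 = 1. Proof. by []. Qed.
Lemma uq_classN a : - uq_class a = uq_class (TOpp a).
Proof. exact: uq_oppE. Qed.
Lemma uq_classD a b : uq_class a + uq_class b = uq_class (TAdd a b).
Proof. exact: uq_addE. Qed.
Lemma uq_classM a b : uq_class a * uq_class b = uq_class (TMul a b).
Proof. exact: uq_mulE. Qed.
Lemma uq_classZ k a : k *: uq_class a = uq_class (TScale k a).
Proof. exact: uq_scaleE. Qed.

Lemma uq_qrelE a b :
  (q - q^-1)^-1 *: (q *: (uq_class a * uq_class b)
                    - q^-1 *: (uq_class b * uq_class a))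
  = uq_class (qrel_term q a b).
Proof.
rewrite (uq_classM a b) (uq_classM b a) (uq_classZ q (TMul a b)).
rewrite (uq_classZ q^-1 (TMul b a)) (uq_classN (TScale q^-1 (TMul b a))).
rewrite (uq_classD (TScale q (TMul a b)) (TOpp (TScale q^-1 (TMul b a)))).
exact: uq_classZ.
Qed.

Lemma uq_relationsP : uq_relations q uq_x uq_y uq_yi uq_z.
Proof.
split; rewrite ?uq_qrelE; first by rewrite uq_classM; apply/uq_classP/cg_yyi.
- by rewrite uq_classM; apply/uq_classP/cg_yiy.
- exact/uq_classP/cg_xy.
- exact/uq_classP/cg_yz.
- exact/uq_classP/cg_zx.
Qed.

Section Lift.
Variables (B : algType K) (x y yi z : B).
Hypothesis rels : uq_relations q x y yi z.

Definition uq_lift_of (r : uq_relations q x y yi z) (u : U) : B :=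
  uq_eval x y yi z (rp u).
Local Notation uq_lift := (uq_lift_of rels).

Lemma uq_lift_class a : uq_lift (uq_class a) = uq_eval x y yi z a.
Proof. exact: uq_eval_cong rels _ _ (uq_repr_class a). Qed.

Lemma uq_liftD : {morph uq_lift : u v / u + v}.
Proof.
move=> u v; have [a ->] := uq_class_surj u; have [b ->] := uq_class_surj v.
by rewrite {1}/GRing.add /= E !uq_lift_class.
Qed.
Lemma uq_liftM : {morph uq_lift : u v / u * v}.
Proof.
move=> u v; have [a ->] := uq_class_surj u; have [b ->] := uq_class_surj v.
by rewrite {1}/GRing.mul /= E !uq_lift_class.
Qed.
Lemma uq_liftZ (k : K) (u : U) : uq_lift (k *: u) = k *: uq_lift u.
Proof.
have [a ->] := uq_class_surj u.
by rewrite {1}/GRing.scale /= E !uq_lift_class.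
Qed.
Lemma uq_lift1 : uq_lift 1 = 1.
Proof. exact: (uq_lift_class T1). Qed.
Lemma uq_lift_x : uq_lift uq_x = x. Proof. exact: uq_lift_class. Qed.
Lemma uq_lift_y : uq_lift uq_y = y. Proof. exact: uq_lift_class. Qed.
Lemma uq_lift_yi : uq_lift uq_yi = yi. Proof. exact: uq_lift_class. Qed.
Lemma uq_lift_z : uq_lift uq_z = z. Proof. exact: uq_lift_class. Qed.
End Lift.

End UqAlgebra.

Arguments uq_x {K q q0 qn}.
Arguments uq_y {K q q0 qn}.
Arguments uq_yi {K q q0 qn}.
Arguments uq_z {K q q0 qn}.

Definition monomial_span (K : fieldType) (q : K) (q0 : q != 0)
    (qn : not_root_of_unity q) (P : nat -> bool) (u : Uq q0 qn) : Prop :=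
  exists (n : nat) (c : 'I_n -> K) (r s t : 'I_n -> nat),
    (forall k, P (r k + s k + t k)%N) /\
    u = \sum_(k < n) c k *: (uq_x ^+ r k * uq_y ^+ s k * uq_z ^+ t k).

Definition even_span (K : fieldType) (q : K) (q0 : q != 0)
    (qn : not_root_of_unity q) : {pred Uq q0 qn} :=
  fun u => `[< monomial_span (fun m => ~~ odd m) u >].

Section EvenSpanClosed.
Variables (K : fieldType) (q : K) (q0 : q != 0) (qn : not_root_of_unity q).
Local Notation U := (Uq q0 qn).
Implicit Types (u v : U) (P : nat -> bool).

Lemma mspan0 P : monomial_span P (0 : U).
Proof.
exists 0%N, (fun _ => 0), (fun _ => 0%N), (fun _ => 0%N), (fun _ => 0%N).
by split=> [[]//|]; rewrite big_ord0.
Qed.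

Lemma mspanD P u v : monomial_span P u -> monomial_span P v ->
  monomial_span P (u + v).
Proof.
move=> [n [c [r [s [t [h ->]]]]]] [n' [c' [r' [s' [t' [h' ->]]]]]].
pose w T (f : 'I_n -> T) (f' : 'I_n' -> T) (k : 'I_(n + n')) :=
  match split k with inl i => f i | inr i => f' i end.
have wl T f f' i : @w T f f' (lshift n' i) = f i.
  by rewrite /w (unsplitK (inl i)).
have wr T f f' i : @w T f f' (rshift n i) = f' i.
  by rewrite /w (unsplitK (inr i)).
exists (n + n')%N, (w _ c c'), (w _ r r'), (w _ s s'), (w _ t t').
split; first by move=> k; rewrite /w; case: split.
by rewrite big_split_ord; congr (_ + _); apply: eq_bigr => i _;
  rewrite ?wl ?wr.
Qed.

Lemma mspanZ P a u : monomial_span P u -> monomial_span P (a *: u).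
Proof.
move=> [n [c [r [s [t [h ->]]]]]].
exists n, (fun k => a * c k), r, s, t; split=> //.
by rewrite scaler_sumr; apply: eq_bigr => i _; rewrite scalerA.
Qed.

Lemma mspan_mon P r s t : P (r + s + t)%N ->
  monomial_span P (uq_x ^+ r * uq_y ^+ s * uq_z ^+ t : U).
Proof.
move=> h; exists 1%N, (fun _ => 1), (fun _ => r), (fun _ => s), (fun _ => t).
by split=> //; rewrite big_ord1 scale1r.
Qed.

Lemma mspan_mull P P' a :
  (forall r s t, P (r + s + t)%N ->
     monomial_span P' (a * (uq_x ^+ r * uq_y ^+ s * uq_z ^+ t) : U)) ->
  forall u, monomial_span P u -> monomial_span P' (a * u).
Proof.
move=> H u [n [c [r [s [t [h ->]]]]]]; rewrite mulr_sumr.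
elim/big_ind: _ => [||i _]; [exact: mspan0 | exact: mspanD |].
by rewrite -scalerAr; apply/mspanZ/H.
Qed.

Lemma q_rel_swapl (a b : U) :
  (q - q^-1)^-1 *: (q *: (a * b) - q^-1 *: (b * a)) = 1 ->
  b * a = q ^+ 2 *: (a * b) + (1 - q ^+ 2)%:A.
Proof.
move=> h; have e : q *: (a * b) - q^-1 *: (b * a) = (q - q^-1)%:A.
  by rewrite -h scalerA mulfV ?q_sub_qV_neq0 // scale1r.
have -> : 1 - q ^+ 2 = - q * (q - q^-1).
  by rewrite mulrBr mulNr mulNr mulfV // opprK expr2 addrC.
rewrite -scalerA -e scalerBr !scalerA mulNr -expr2 mulNr mulfV // scaleNr.
by rewrite scaleN1r opprK addrA subrr add0r.
Qed.

Lemma q_rel_swapr (a b : U) :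
  (q - q^-1)^-1 *: (q *: (a * b) - q^-1 *: (b * a)) = 1 ->
  a * b = q ^- 2 *: (b * a) + (1 - q ^- 2)%:A.
Proof.
move=> /q_rel_swapl ->.
have q2 : q ^+ 2 != 0 by rewrite expf_neq0.
rewrite scalerDr !scalerA mulVf // scale1r -addrA -scalerDl.
by rewrite mulrBr mulVf // mulr1 addrA subrK subrr scale0r addr0.
Qed.

Let S k : U -> Prop := monomial_span (fun m => ~~ odd (k + m)).

Let S2 k u : S k.+2 u -> S k u.
Proof.
move=> [n [c [r [s [t [h ->]]]]]]; exists n, c, r, s, t; split=> // i.
by have := h i; rewrite !addSn /= negbK.
Qed.

Let S2' k u : S k u -> S k.+2 u.
Proof.
move=> [n [c [r [s [t [h ->]]]]]]; exists n, c, r, s, t; split=> // i.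
by have := h i; rewrite !addSn /= negbK.
Qed.

Let Sx k u : S k u -> S k.+1 (uq_x * u).
Proof.
apply: mspan_mull => r s t h; rewrite !mulrA -exprS; apply: mspan_mon.
by move: h; rewrite !addSn !addnS /= negbK.
Qed.

Let Sy k u : S k u -> S k.+1 (uq_y * u).
Proof.
apply: mspan_mull => r s t; elim: r k => [|r IH] k h.
  rewrite expr0 mul1r mulrA -exprS -(mul1r (uq_y ^+ s.+1)) -(expr0 uq_x).
  by apply: mspan_mon; move: h; rewrite !addSn !addnS /= negbK.
have [_ _ r1 _ _] := uq_relationsP q0 qn.
rewrite exprS -!mulrA [uq_y * _]mulrA (q_rel_swapl r1) mulrDl -!scalerAl.
rewrite mul1r -mulrA !mulrA -(mulrA (uq_x * _)) -(mulrA uq_x) -(mulrA uq_x).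
have hr : ~~ odd (k.+1 + (r + s + t)) by move: h; rewrite !addSn !addnS.
apply: mspanD; apply: mspanZ; last exact: mspan_mon.
by apply/S2/Sx; have := IH _ hr; rewrite !mulrA.
Qed.

Let Sz k u : S k u -> S k.+1 (uq_z * u).
Proof.
have [_ _ _ r2 r3] := uq_relationsP q0 qn.
apply: mspan_mull => r s t; elim: r k => [|r IH] k h.
  rewrite expr0 mul1r; elim: s k h => [|s IH] k h.
    rewrite expr0 mul1r -exprS -[uq_z ^+ _]mul1r -(expr0 uq_y).
    rewrite -[uq_y ^+ 0]mul1r -(expr0 uq_x).
    by apply: mspan_mon; move: h; rewrite !addSn !addnS /= negbK.
  rewrite exprS !mulrA (q_rel_swapl r2) !mulrDl -!scalerAl mul1r.
  have hr : ~~ odd (k.+1 + (0 + s + t)) by move: h; rewrite !addSn !addnS.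
  apply: mspanD; apply: mspanZ; last first.
    rewrite -[uq_y ^+ s]mul1r -(expr0 uq_x); exact: mspan_mon.
  by rewrite -!mulrA; apply/S2/Sy; exact: IH hr.
rewrite exprS !mulrA (q_rel_swapr r3) !mulrDl -!scalerAl mul1r.
have hr : ~~ odd (k.+1 + (r + s + t)) by move: h; rewrite !addSn !addnS.
apply: mspanD; apply: mspanZ; last exact: mspan_mon.
rewrite -!mulrA; apply/S2/Sx; have := IH _ hr; by rewrite !mulrA.
Qed.

Let SX (a : U) : (forall k u, S k u -> S k.+1 (a * u)) ->
  forall n k u, S k u -> S (n + k) (a ^+ n * u).
Proof.
move=> h; elim=> [|n IH] k u ku; first by rewrite expr0 mul1r.
by rewrite exprS -mulrA addSn; apply/h/IH.
Qed.

Let Seven k u : ~~ odd k -> S k u -> S 0 u.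
Proof.
move=> ek [n [c [r [s [t [h ->]]]]]]; exists n, c, r, s, t; split=> // i.
by have := h i; rewrite add0n oddD (negbTE ek).
Qed.

Lemma even_span_subalg : GRing.subsemialg_closed (@even_span K q q0 qn).
Proof.
split.
- by apply/asboolP; have := @mspan_mon (fun m => ~~ odd m) 0 0 0 isT;
    rewrite !expr0 !mulr1.
- split=> [|u v /asboolP hu /asboolP hv]; first by apply/asboolP/mspan0.
  exact/asboolP/mspanD.
- by move=> a u /asboolP hu; apply/asboolP/mspanZ.
move=> u v /asboolP [n [c [r [s [t [h ->]]]]]] /asboolP hv; apply/asboolP.
rewrite mulr_suml; elim/big_ind: _ => [||i _]; [exact: mspan0|exact: mspanD|].
rewrite -scalerAl; apply: mspanZ; rewrite -!mulrA.
apply: (@Seven (r i + (s i + (t i + 0)))); first by rewrite addn0 addnA.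
by apply: (SX Sx); apply: (SX Sy); apply: (SX Sz).
Qed.

End EvenSpanClosed.

HB.instance Definition _ (K : fieldType) (q : K) (q0 : q != 0)
    (qn : not_root_of_unity q) :=
  GRing.isSubSemiAlgClosed.Build K (Uq q0 qn) (@even_span K q q0 qn)
    (even_span_subalg q0 qn).

Definition Aq (K : fieldType) (q : K) (q0 : q != 0)
    (qn : not_root_of_unity q) : Type := {u : Uq q0 qn | even_span u}.

Section AqAlgebra.
Variables (K : fieldType) (q : K) (q0 : q != 0) (qn : not_root_of_unity q).
HB.instance Definition _ := SubChoice.on (Aq q0 qn).
HB.instance Definition _ := [SubChoice_isSubAlgebra of Aq q0 qn by <:].
End AqAlgebra.

(* Restriction of scalars from Uq to Aq *)
Definition resA (K : fieldType) (q : K) (q0 : q != 0)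
    (qn : not_root_of_unity q) (V : lmodType (Uq q0 qn)) : Type := V.

Section Restriction.
Variables (K : fieldType) (q : K) (q0 : q != 0) (qn : not_root_of_unity q).
Variable V : lmodType (Uq q0 qn).
HB.instance Definition _ := GRing.Zmodule.on (resA V).

Definition resA_scale (a : Aq q0 qn) (v : resA V) : resA V :=
  \val a *: (v : V).

Let scaleA a b v : resA_scale a (resA_scale b v) = resA_scale (a * b) v.
Proof. by rewrite /resA_scale scalerA rmorphM. Qed.
Let scale1 : left_id 1 resA_scale.
Proof. by move=> v; rewrite /resA_scale rmorph1 scale1r. Qed.
Let scaleDr : right_distributive resA_scale +%R.
Proof. by move=> a u v; rewrite /resA_scale scalerDr. Qed.
Let scaleDl v : {morph resA_scale^~ v : a b / a + b}.
Proof. by move=> a b; rewrite /resA_scale rmorphD scalerDl. Qed.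
HB.instance Definition _ :=
  GRing.Zmodule_isLmodule.Build (Aq q0 qn) (resA V)
    scaleA scale1 scaleDr scaleDl.
End Restriction.

(* The standard basis of K^(d+1), extended by zero to all integer indices; in
   particular u_(-1) = u_(d+1) = 0. *)
Definition ubas (K : fieldType) (d : nat) (k : int) : 'cV[K]_d.+1 :=
  \col_j (j%:Z == k)%:R.

Section LModule.
Variables (K : fieldType) (q : K) (q0 : q != 0) (qn : not_root_of_unity q).
Variables (d : nat) (e : bool).
Local Notation eps := ((-1) ^+ e : K).
Local Notation u := (ubas K d).

Definition Lx_col (k : int) : 'cV[K]_d.+1 :=
  eps *: (q ^ (d%:Z - 2 * k) *: u k
          + (q ^ (- d%:Z) - q ^ (d%:Z - 2 * k + 2)) *: u (k - 1)).
Definition Ly_col (k : int) : 'cV[K]_d.+1 :=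
  eps *: (q ^ (d%:Z - 2 * k) *: u k
          + (q ^ d%:Z - q ^ (d%:Z - 2 * k - 2)) *: u (k + 1)).
Definition Lz_col (k : int) : 'cV[K]_d.+1 :=
  eps *: (q ^ (2 * k - d%:Z) *: u k).

Definition Lx_mx : 'M[K]_d.+1 := \matrix_(j, i) Lx_col i%:Z j 0.
Definition Ly_mx : 'M[K]_d.+1 := \matrix_(j, i) Ly_col i%:Z j 0.
Definition Lz_mx : 'M[K]_d.+1 := \matrix_(j, i) Lz_col i%:Z j 0.

Lemma ubas_out k : ~~ (0 <= k <= d%:Z) -> u k = 0.
Proof.
move=> h; apply/colP => j; rewrite !mxE; case: eqP => // jk; case/negP: h.
by rewrite -jk /= lez_nat -ltnS ltn_ord.
Qed.

Lemma ubas_ord (i : 'I_d.+1) : u i%:Z = delta_mx i 0.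
Proof. by apply/colP => j; rewrite !mxE eqxx andbT. Qed.

Lemma ubas_case k : (exists i : 'I_d.+1, k = i%:Z) \/ ~~ (0 <= k <= d%:Z).
Proof.
case: (boolP (0 <= k <= d%:Z)) => h; [left|by right].
case: k h => // n; rewrite /= lez_nat -ltnS => hn; by exists (Ordinal hn).
Qed.

Lemma mx_ubas_ord (f : int -> 'cV[K]_d.+1) (i : 'I_d.+1) :
  (\matrix_(j, i) f i%:Z j 0) *m u i%:Z = f i%:Z.
Proof. by rewrite ubas_ord -colE; apply/colP => j; rewrite !mxE. Qed.

Lemma Lx_mxE k : Lx_mx *m u k = Lx_col k.
Proof.
have [[i ->]|h] := ubas_case k; first exact: mx_ubas_ord.
rewrite /Lx_col ubas_out // mulmx0 scaler0 add0r.
case: (eqVneq k (d%:Z + 1)) => [->|kd].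
  have -> : d%:Z - 2 * (d%:Z + 1) + 2 = - d%:Z by ring.
  by rewrite subrr scale0r scaler0.
rewrite ubas_out ?scaler0 //; move: h kd; clear; lia.
Qed.

Lemma Ly_mxE k : Ly_mx *m u k = Ly_col k.
Proof.
have [[i ->]|h] := ubas_case k; first exact: mx_ubas_ord.
rewrite /Ly_col ubas_out // mulmx0 scaler0 add0r.
case: (eqVneq k (- 1)) => [->|kd].
  have -> : d%:Z - 2 * (- 1) - 2 = d%:Z by ring.
  by rewrite subrr scale0r scaler0.
rewrite ubas_out ?scaler0 //; move: h kd; clear; lia.
Qed.

Lemma Lz_mxE k : Lz_mx *m u k = Lz_col k.
Proof.
have [[i ->]|h] := ubas_case k; first exact: mx_ubas_ord.
by rewrite /Lz_col ubas_out // mulmx0 !scaler0.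
Qed.

Lemma mx_ubas_inj (A B : 'M[K]_d.+1) :
  (forall k, A *m u k = B *m u k) -> A = B.
Proof.
move=> h; apply/matrixP => j i; have := h i%:Z.
by rewrite ubas_ord -!colE => /colP /(_ j); rewrite !mxE.
Qed.

Let epsK : eps * eps = 1.
Proof. by rewrite -expr2 sqrr_sign. Qed.

Lemma Ly_unit : Ly_mx \in unitmx.
Proof.
rewrite unitmxE det_trig; last first.
  apply/is_trig_mxP => i j ij; rewrite !mxE.
  have -> : (i%:Z == j%:Z) = false by apply/negbTE; lia.
  have -> : (i%:Z == j%:Z + 1) = false by apply/negbTE; lia.
  by rewrite !mulr0 addr0 mulr0.
rewrite unitfE; apply/prodf_neq0 => i _; rewrite !mxE eqxx.
have -> : (i%:Z == i%:Z + 1) = false by apply/negbTE; lia.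
by rewrite mulr0 addr0 mulr1 mulf_neq0 ?signr_eq0 // expfz_neq0.
Qed.

Let wD k : q ^ (d%:Z - 2 * k + 2) = q ^ (d%:Z - 2 * k) * q ^+ 2.
Proof. by rewrite expfzDr. Qed.
Let wB k : q ^ (d%:Z - 2 * k - 2) = q ^ (d%:Z - 2 * k) / q ^+ 2.
Proof. by rewrite expfzDr. Qed.
Let wV k : q ^ (2 * k - d%:Z) = (q ^ (d%:Z - 2 * k))^-1.
Proof. by rewrite -opprB -invr_expz. Qed.
Let wS k : q ^ (d%:Z - 2 * (k + 1)) = q ^ (d%:Z - 2 * k) / q ^+ 2.
Proof. by rewrite -wB; congr (q ^ _); ring. Qed.
Let wP k : q ^ (d%:Z - 2 * (k - 1)) = q ^ (d%:Z - 2 * k) * q ^+ 2.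
Proof. by rewrite -wD; congr (q ^ _); ring. Qed.
Let w_neq0 k : q ^ (d%:Z - 2 * k) != 0.
Proof. exact: expfz_neq0. Qed.

Lemma L_relations :
  uq_relations q Lx_mx Ly_mx (invmx Ly_mx) Lz_mx.
Proof.
have nz := q_sub_qV_neq0 q0 qn.
have qrelP (A B : 'M[K]_d.+1) :
    (forall k, q *: (A *m (B *m u k)) - q^-1 *: (B *m (A *m u k))
               = (q - q^-1) *: u k) ->
    (q - q^-1)^-1 *: (q *: (A * B) - q^-1 *: (B * A)) = 1.
  move=> h; apply: mx_ubas_inj => k; rewrite -!mulmxE mul1mx -scalemxAl.
  rewrite mulmxBl -!scalemxAl -!mulmxA h scalerA mulVf // scale1r.
  by [].
split.
- by rewrite -mulmxE mulmxV ?Ly_unit.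
- by rewrite -mulmxE mulVmx ?Ly_unit.
- apply: qrelP => k; rewrite Lx_mxE Ly_mxE /Lx_col /Ly_col.
  rewrite -!scalemxAr !mulmxDr -!scalemxAr !Lx_mxE !Ly_mxE /Lx_col /Ly_col.
  rewrite ?addrK ?subrK !(wD, wB, wS, wP) -invr_expz.
  move: (w_neq0 k) (expfz_neq0 d%:Z q0).
  move: (q ^ (d%:Z - 2 * k)) (q ^ d%:Z) => W Q W0 Q0.
  move: (u k) (u (k + 1)) (u (k - 1)) => u0 u1 um.
  by apply/colP => j; rewrite !mxE; case: (e); field; rewrite ?q0 ?Q0 ?W0.
- apply: qrelP => k; rewrite Ly_mxE Lz_mxE /Ly_col /Lz_col.
  rewrite -!scalemxAr !mulmxDr -!scalemxAr !Lz_mxE !Ly_mxE /Lz_col /Ly_col.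
  rewrite !(wD, wB, wV, wS, wP).
  move: (w_neq0 k) (expfz_neq0 d%:Z q0).
  move: (q ^ (d%:Z - 2 * k)) (q ^ d%:Z) => W Q W0 Q0.
  move: (u k) (u (k + 1)) => u0 u1.
  by apply/colP => j; rewrite !mxE; case: (e); field; rewrite ?q0 ?Q0 ?W0.
apply: qrelP => k; rewrite Lx_mxE Lz_mxE /Lx_col /Lz_col.
rewrite -!scalemxAr !mulmxDr -!scalemxAr !Lz_mxE !Lx_mxE /Lz_col /Lx_col.
rewrite !(wD, wB, wV, wS, wP) -invr_expz.
move: (w_neq0 k) (expfz_neq0 d%:Z q0).
move: (q ^ (d%:Z - 2 * k)) (q ^ d%:Z) => W Q W0 Q0.
move: (u k) (u (k - 1)) => u0 um.
by apply/colP => j; rewrite !mxE; case: (e); field; rewrite ?q0 ?Q0 ?W0.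
Qed.

End LModule.

(* L(d, (-1)^e): the Uq-module structure on K^(d+1) obtained by lifting the
   matrices of x, y, z to Uq. Thus e = false is epsilon = 1 and e = true is
   epsilon = -1. *)
Definition L (K : fieldType) (q : K) (q0 : q != 0)
  (qn : not_root_of_unity q) (d : nat) (e : bool) : Type := 'cV[K]_d.+1.

Section LStructure.
Variables (K : fieldType) (q : K) (q0 : q != 0) (qn : not_root_of_unity q).
Variables (d : nat) (e : bool).
Local Notation U := (Uq q0 qn).
Local Notation V := (L q0 qn d e).

HB.instance Definition _ := GRing.Zmodule.copy V 'cV[K]_d.+1.

Definition L_rep : U -> 'M[K]_d.+1 := uq_lift_of (L_relations q0 qn d e).

Definition L_scale (a : U) (v : V) : V := L_rep a *m (v : 'cV[K]_d.+1).

Let scaleA a b v : L_scale a (L_scale b v) = L_scale (a * b) v.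
Proof. by rewrite /L_scale mulmxA /L_rep uq_liftM -mulmxE. Qed.
Let scale1 : left_id 1 L_scale.
Proof. by move=> v; rewrite /L_scale /L_rep uq_lift1 mul1mx. Qed.
Let scaleDr : right_distributive L_scale +%R.
Proof. by move=> a u v; rewrite /L_scale mulmxDr. Qed.
Let scaleDl v : {morph L_scale^~ v : a b / a + b}.
Proof. by move=> a b; rewrite /L_scale /L_rep uq_liftD mulmxDl. Qed.

HB.instance Definition _ :=
  GRing.Zmodule_isLmodule.Build U V scaleA scale1 scaleDr scaleDl.

(* The basis vector u_k of L(d, (-1)^e), zero unless 0 <= k <= d *)
Definition Lu (k : int) : V := ubas K d k.

Lemma L_scaleE (c : K) (v : V) : (c%:A : U) *: v = c *: (v : 'cV[K]_d.+1).
Proof.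
rewrite /GRing.scale /= /L_scale /L_rep uq_liftZ uq_lift1.
by rewrite -scalemxAl mul1mx.
Qed.

Local Notation eps := ((-1) ^+ e : U).

Let epsA : eps = ((-1) ^+ e : K)%:A.
Proof. by case: e; rewrite ?expr0 ?scale1r // !expr1 scaleN1r. Qed.

Let epsK (v : 'cV[K]_d.+1) :
  ((-1) ^+ e : K) *: (((-1) ^+ e : K) *: v) = v.
Proof. by rewrite scalerA -expr2 sqrr_sign scale1r. Qed.

Lemma L_x (k : int) :
  (eps * uq_x - (q ^ (d%:Z - 2 * k))%:A) *: Lu k
  = ((q ^ (- d%:Z) - q ^ (d%:Z - 2 * k + 2))%:A : U) *: Lu (k - 1).
Proof.
rewrite scalerBl -scalerA epsA !L_scaleE.
rewrite [uq_x *: _](_ : _ = Lx_mx q d e *m ubas K d k); last first.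
  by rewrite /GRing.scale /= /L_scale /L_rep uq_lift_x.
by rewrite Lx_mxE /Lx_col epsK addrAC subrr add0r.
Qed.

Lemma L_y (k : int) :
  (eps * uq_y - (q ^ (d%:Z - 2 * k))%:A) *: Lu k
  = ((q ^ d%:Z - q ^ (d%:Z - 2 * k - 2))%:A : U) *: Lu (k + 1).
Proof.
rewrite scalerBl -scalerA epsA !L_scaleE.
rewrite [uq_y *: _](_ : _ = Ly_mx q d e *m ubas K d k); last first.
  by rewrite /GRing.scale /= /L_scale /L_rep uq_lift_y.
by rewrite Ly_mxE /Ly_col epsK addrAC subrr add0r.
Qed.

Lemma L_z (k : int) :
  (eps * uq_z) *: Lu k = ((q ^ (2 * k - d%:Z))%:A : U) *: Lu k.
Proof.
rewrite -scalerA epsA !L_scaleE.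
rewrite [uq_z *: _](_ : _ = Lz_mx q d e *m ubas K d k); last first.
  by rewrite /GRing.scale /= /L_scale /L_rep uq_lift_z.
by rewrite Lz_mxE /Lz_col epsK.
Qed.

End LStructure.

(* Main.v *)
Require Import Defs.
From HB Require Import structures.
From mathcomp Require Import all_boot all_order all_algebra.
From mathcomp Require Import boolp.

Import GRing.Theory.
Local Open Scope ring_scope.

(** The modules L(d, 1) and L(d, -1) are both K^(d+1) with the same basis u_i,
    so the isomorphism can only be the identity map, and what has to be seen
    is that this map commutes with the even subalgebra.  Write eps = (-1)^e.
    In the formulas defining L(d, eps) the generators x, y, z occur only as
    eps x, eps y, eps z, so each of them acts on L(d, eps) by eps times its
    action on L(d, 1).  Hence x^r y^s z^t acts on L(d, eps) by eps^(r+s+t)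
    times its action on L(d, 1) ([L_rep_monomial]), and the sign disappears
    when r + s + t is even.  Since such monomials span the even subalgebra,
    its elements act on both modules by the same matrix ([L_rep_even]). *)

Section SignTwist.
Variables (K : fieldType) (q : K) (q0 : q != 0) (qn : not_root_of_unity q).
Variables (d : nat).

Section Representation.
Variable e : bool.

Local Notation rep := (@L_rep K q q0 qn d e).

Lemma L_rep_linear : linear rep.
Proof. by move=> k u v; rewrite /L_rep uq_liftD uq_liftZ. Qed.

Lemma L_rep_monoid_morphism : monoid_morphism rep.
Proof. by split=> [|u v]; rewrite /L_rep (uq_lift1, uq_liftM). Qed.

HB.instance Definition _ := GRing.isLinear.Build K _ _ _ rep L_rep_linear.
HB.instance Definition _ :=
  GRing.isMonoidMorphism.Build _ _ rep L_rep_monoid_morphism.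

End Representation.

Variable e : bool.

Lemma Lx_mx_sign : Lx_mx q d e = (-1) ^+ e *: Lx_mx q d false.
Proof. by apply/matrixP => i j; rewrite !mxE expr0 mul1r. Qed.

Lemma Ly_mx_sign : Ly_mx q d e = (-1) ^+ e *: Ly_mx q d false.
Proof. by apply/matrixP => i j; rewrite !mxE expr0 mul1r. Qed.

Lemma Lz_mx_sign : Lz_mx q d e = (-1) ^+ e *: Lz_mx q d false.
Proof. by apply/matrixP => i j; rewrite !mxE expr0 mul1r. Qed.

(** Each of the r + s + t generator factors contributes one sign. *)
Lemma L_rep_monomial (r s t : nat) :
  @L_rep K q q0 qn d e (uq_x ^+ r * uq_y ^+ s * uq_z ^+ t)
  = ((-1) ^+ e) ^+ (r + s + t)
    *: @L_rep K q q0 qn d false (uq_x ^+ r * uq_y ^+ s * uq_z ^+ t).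
Proof.
rewrite !rmorphM !rmorphXn /= /L_rep !uq_lift_x !uq_lift_y !uq_lift_z.
rewrite Lx_mx_sign Ly_mx_sign Lz_mx_sign !exprZn.
by rewrite -!(scalerAl, scalerAr) !scalerA !exprD [X in X *: _]mulrC.
Qed.

Lemma L_rep_even (u : Uq q0 qn) :
  even_span u -> @L_rep K q q0 qn d e u = @L_rep K q q0 qn d false u.
Proof.
move=> /asboolP [n [c [r [s [t [even_rst ->]]]]]].
rewrite !linear_sum; apply: eq_bigr => k _; rewrite !linearZ /=.
rewrite L_rep_monomial -exprM mulnC exprM -signr_odd.
by rewrite (negbTE (even_rst k)) expr0 expr1n scale1r.
Qed.

(** A named identity map, because source and target are the same space with
    two module structures that instance inference must tell apart. *)
Definition L_twist (v : resA (L q0 qn d false)) : resA (L q0 qn d e) := v.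

Lemma L_twist_linear : linear L_twist.
Proof.
move=> a u v; congr (_ + _).
by rewrite /L_twist [RHS]/(@L_rep K q q0 qn d e (\val a) *m _) (L_rep_even _ (valP a)).
Qed.

HB.instance Definition _ :=
  GRing.isLinear.Build (Aq q0 qn) _ _ _ L_twist L_twist_linear.

End SignTwist.

Theorem lemma7p1 (K : fieldType) (q : K) (q0 : q != 0)
    (qn : not_root_of_unity q) (d : nat) :
  exists f : {linear resA (L q0 qn d false) -> resA (L q0 qn d true)},
    bijective f /\
    forall i : nat, (i <= d)%N ->
      f (Lu q0 qn d false i%:Z) = Lu q0 qn d true i%:Z.
Proof.
exists (L_twist K q q0 qn d true : {linear _ -> _}); split=> //.
by exists (fun v => v).
Qed.
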